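(* Let $A$ be an algebra and consider a strong resolution of finite length of the Hilbert module $\mathcal{M}_0$ over $A$: \[ 0 \longleftarrow \mathcal{M}_0 \overset{X_0}{\longleftarrow} \mathcal{M}_1 \longleftarrow \cdots \overset{X_n}{\longleftarrow} \mathcal{M}_{n+1} \longleftarrow 0 . \] If each $\mathcal{M}_i$, $1\le i\le n+1$, is essentially reductive, then so is $\mathcal{M}_0$.
   Context: A Hilbert module over a complex algebra $A$ is a complex Hilbert space $\mathcal{M}$ that is a module over $A$ such that for each $\varphi\in A$ the module multiplication $M_\varphi f=\varphi\cdot f$ is a bounded operator on $\mathcal{M}$. It is essentially reductive if for every $\varphi\in A$ the self-commutator $[M_\varphi^*,M_\varphi]=M_\varphi^*M_\varphi-M_\varphi M_\varphi^*$ is compact. A module map is a bounded linear operator between Hilbert modules over $A$ that intertwines the actions of $A$. A resolution of finite length of $\mathcal{M}_0$ consists of Hilbert modules $\mathcal{M}_1,\dots,\mathcal{M}_{n+1}$ over $A$ and module maps $X_i:\mathcal{M}_{i+1}\to\mathcal{M}_i$ ($0\le i\le n$) with $\operatorname{range}(X_0)=\mathcal{M}_0$, $\operatorname{range}(X_{i+1})=\ker(X_i)$ for $0\le i<n$, and $\ker(X_n)=(0)$. The resolution is strong if all the module maps $X_i$ are partial isometries. *)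

(* Defs.v *)
(* MathComp-Analysis. *)
From HB Require Import structures.
From mathcomp Require Import all_boot all_order all_algebra.
From mathcomp Require Import complex.
From mathcomp Require Import boolp classical_sets reals topology normedtype.

Set Implicit Arguments.
Unset Strict Implicit.
Unset Printing Implicit Defensive.

Import Order.TTheory GRing.Theory Num.Theory.

Local Open Scope classical_set_scope.
Local Open Scope ring_scope.

(* Associative algebras over the complex numbers R[i]. Neither a unit nor
   commutativity is assumed, which is why algType is not used. *)
HB.mixin Record Lmodule_isComplexAlgebra (R : realType) A
    & GRing.Lmodule R[i] A := {
  amul : A -> A -> A;
  amulA : associative amul;
  amul_linearl : forall b : A, linear (amul^~ b);
  amul_linearr : forall a : A, linear (amul a)
}.

#[short(type="complexAlgType")]
HB.structure Definition ComplexAlgebra (R : realType) :=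
  {A of GRing.Lmodule R[i] A & Lmodule_isComplexAlgebra R A}.

(* The inner product is linear in its first argument. Positive definiteness
   follows from hdotE and the norm axioms. *)
HB.mixin Record CompleteNormedModule_isHilbert (R : realType) H
    & CompleteNormedModule R[i] H := {
  hdot : H -> H -> R[i];
  hdot_linearl : forall y : H, scalar (hdot^~ y);
  hdotC : forall x y : H, hdot y x = (hdot x y)^*;
  hdotE : forall x : H, hdot x x = `|x| ^+ 2
}.

#[short(type="hilbertType")]
HB.structure Definition Hilbert (R : realType) :=
  {H of CompleteNormedModule R[i] H & CompleteNormedModule_isHilbert R H}.

Section Operators.
Context {R : realType}.
Implicit Types H K : hilbertType R.

Definition bounded_operator H K (T : H -> K) : Prop :=
  linear T /\ exists c : R[i], forall x, `|T x| <= c * `|x|.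

Definition operator_ker H K (T : H -> K) : set H := T @^-1` [set 0].

Definition orthogonal_complement H (V : set H) : set H :=
  [set x | forall y, V y -> hdot x y = 0].

Definition is_adjoint H K (T : H -> K) (S : K -> H) : Prop :=
  forall x y, hdot (T x) y = hdot x (S y).

(* A map has at most one adjoint, and a bounded operator has one by the Riesz
   representation theorem. The value 0 is taken only when there is none. *)
Definition adjoint H K (T : H -> K) : K -> H :=
  xget (fun=> 0) [set S | is_adjoint T S].

Definition self_commutator H (T : H -> H) : H -> H :=
  fun x => adjoint T (T x) - T (adjoint T x).

Definition compact_operator H K (T : H -> K) : Prop :=
  linear T /\ precompact (T @` [set x | `|x| <= 1]).

Definition partial_isometry H K (T : H -> K) : Prop :=
  forall x, orthogonal_complement (operator_ker T) x -> `|T x| = `|x|.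

End Operators.

HB.mixin Record Hilbert_isHilbertModule (R : realType) (A : complexAlgType R) M
    & Hilbert R M := {
  act : A -> M -> M;
  act_linearl : forall f : M, linear (act^~ f);
  actM : forall (a b : A) (f : M), act (amul a b) f = act a (act b f);
  act_bounded : forall a : A, bounded_operator (act a)
}.

#[short(type="hilbertModType")]
HB.structure Definition HilbertModule (R : realType) (A : complexAlgType R) :=
  {M of Hilbert R M & Hilbert_isHilbertModule R A M}.

Section HilbertModules.
Context {R : realType} {A : complexAlgType R}.
Implicit Types M N : hilbertModType A.

Definition essentially_reductive M : Prop :=
  forall a : A, compact_operator (self_commutator (act a : M -> M)).

Definition module_map M N (X : M -> N) : Prop :=
  bounded_operator X /\ forall (a : A) (f : M), X (act a f) = act a (X f).

(* The families are indexed by all of nat only to avoid casts: the terms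
   M 0, ..., M n.+1 and X 0, ..., X n are the resolution, and nothing is
   required of the others. *)
Definition resolution (n : nat) (M : nat -> hilbertModType A)
    (X : forall i, M i.+1 -> M i) : Prop :=
  [/\ forall i, (i <= n)%N -> module_map (X i),
      range (X 0%N) = setT,
      forall i, (i < n)%N -> range (X i.+1) = operator_ker (X i)
    & operator_ker (X n) = [set 0] ].

Definition strong_resolution (n : nat) (M : nat -> hilbertModType A)
    (X : forall i, M i.+1 -> M i) : Prop :=
  resolution n X /\ forall i, (i <= n)%N -> partial_isometry (X i).

End HilbertModules.

(* Main.v *)
(* A short exact sequence 0 <- N <- M <- L <- 0 of module maps that are partial
   isometries identifies L with a submodule of M and N with the quotient of M
   by it. Write the action of an element on M as T = [[A, B], [0, C]] along
   L + L^perp. If [T*, T] and [A*, A] are compact, the upper left corner of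
   [T*, T] shows that B B* is compact, hence so is B, and then the lower right
   corner shows that [C*, C] is compact. This is applied along the resolution
   from M_{n+1} down to M_0, the submodule L being range (X_{i+1}) = ker (X_i).

   All these blocks are kept as operators on the whole M_i, compressed by the
   projections X* X and X X*, so that no subspace has to be made a Hilbert
   space. Compactness is handled as total boundedness of the image of the unit
   ball, in the form of a finite coloring of the ball. *)
Require Import Defs.
From mathcomp Require Import all_boot all_order all_algebra.
From mathcomp Require Import reals.
From mathcomp Require Import finmap complex boolp classical_sets topology normedtype.
From mathcomp Require Import ring lra.

Set Implicit Arguments.
Unset Strict Implicit.
Unset Printing Implicit Defensive.

Import Order.TTheory GRing.Theory Num.Theory.
Import numFieldNormedType.Exports.

Local Open Scope classical_set_scope.
Local Open Scope ring_scope.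

(** * Algebra of the inner product and the Cauchy-Schwarz inequality *)

Section InnerProduct.
Context {R : realType} {H : hilbertType R}.
Implicit Types (x y z : H) (a : R[i]).

Lemma hdotDl x y z : hdot (x + y) z = hdot x z + hdot y z.
Proof. by have := hdot_linearl z 1 x y; rewrite scale1r /= mul1r. Qed.

Lemma hdot0l z : hdot 0 z = 0.
Proof. by apply: (addrI (hdot 0 z)); rewrite -hdotDl !addr0. Qed.

Lemma hdotZl a x z : hdot (a *: x) z = a * hdot x z.
Proof. by have := hdot_linearl z a x 0; rewrite !addr0 /= hdot0l addr0. Qed.

Lemma hdotBl x y z : hdot (x - y) z = hdot x z - hdot y z.
Proof. by rewrite hdotDl -scaleN1r hdotZl mulN1r. Qed.

Lemma hdotDr x y z : hdot z (x + y) = hdot z x + hdot z y.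
Proof. by rewrite hdotC hdotDl rmorphD /= [hdot z x]hdotC [hdot z y]hdotC. Qed.

Lemma hdotZr a x z : hdot z (a *: x) = a^* * hdot z x.
Proof. by rewrite hdotC hdotZl rmorphM /= [hdot z x]hdotC. Qed.

Lemma hdotBr x y z : hdot z (x - y) = hdot z x - hdot z y.
Proof. by rewrite hdotC hdotBl rmorphB /= [hdot z x]hdotC [hdot z y]hdotC. Qed.

Lemma hdot_eq0 x : (hdot x x == 0) = (x == 0).
Proof. by rewrite hdotE expf_eq0 /= normr_eq0. Qed.

Lemma hdot_ext x y : (forall z, hdot z x = hdot z y) -> x = y.
Proof.
move=> xy; apply/eqP; rewrite -subr_eq0 -hdot_eq0 hdotBr.
by rewrite xy subrr.
Qed.

(** Up to the factor [hdot y y > 0], the difference of the squared sides is the squared norm of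
    [hdot y y *: x - hdot x y *: y]. *)
Lemma cauchy_schwarz x y : `|hdot x y| <= `|x| * `|y|.
Proof.
have [->|y0] := eqVneq y 0.
  by rewrite hdotC hdot0l conjC0 !normr0 mulr0.
rewrite -(@ler_pXn2r _ 2) ?nnegrE ?mulr_ge0 //.
have yy0 : 0 < hdot y y by rewrite hdotE exprn_gt0 // normr_gt0.
rewrite -subr_ge0 -(pmulr_rge0 _ yy0).
have -> : hdot y y * ((`|x| * `|y|) ^+ 2 - `|hdot x y| ^+ 2) =
    hdot (hdot y y *: x - hdot x y *: y) (hdot y y *: x - hdot x y *: y).
  rewrite normCK exprMn -!hdotE !hdotBl !hdotBr !hdotZl !hdotZr -!hdotC; ring.
by rewrite hdotE exprn_ge0.
Qed.

End InnerProduct.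

(** * The Riesz representation theorem *)

Section Riesz.
Context {R : realType} {H : hilbertType R}.
Variables (f : H -> R[i]) (c : R).
Hypotheses (f_scalar : scalar f) (f_bound : forall x, `|f x| <= c%:C%C * `|x|).
Implicit Types (x y h : H).

Let fD x y : f (x + y) = f x + f y.
Proof. by have := f_scalar 1 x y; rewrite scale1r /= mul1r. Qed.

Let f0 : f 0 = 0.
Proof. by apply: (addrI (f 0)); rewrite -fD !addr0. Qed.

Let fZ a x : f (a *: x) = a * f x.
Proof. by have := f_scalar a x 0; rewrite !addr0 f0 addr0. Qed.

(* [f] is represented by the minimizer of [|x|^2 - 2 Re (f x)]. *)
Let energy x : R[i] := hdot x x - f x - (f x)^*.
(** The real part is needed to take an infimum, since [R[i]] is only partially ordered. *)
Let energyR x : R := complex.Re (energy x).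

Let energyE x : energy x = (energyR x)%:C%C.
Proof.
rewrite /energyR RRe_real // /energy -addrA -opprD CrealE.
by rewrite rmorphB rmorphD /= conjCK -hdotC [f x + _]addrC.
Qed.

(** Completing the square: [|x|^2 - 2 c |x| + c^2] is [(|x| - c)^2]. *)
Let energy_lb x : (- c ^+ 2)%:C%C <= energy x.
Proof.
have fx : f x + (f x)^* <= 2 * c%:C%C * `|x|.
  have fxR : f x + (f x)^* \is Num.real.
    by rewrite CrealE rmorphD /= conjCK addrC.
  apply: le_trans (real_ler_norm fxR) _.
  apply: le_trans (ler_normD _ _) _.
  by rewrite norm_conjC -mulr2n -[leLHS]mulr_natl -mulrA ler_pM2l // ltr0n.
have sq0 : 0 <= (`|x| - c%:C%C) ^+ 2.
  by rewrite real_exprn_even_ge0 // rpredB ?normr_real // complex_real.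
rewrite /energy -addrA -opprD hdotE.
apply: (le_trans _ (lerB (lexx (`|x| ^+ 2)) fx)).
rewrite -subr_ge0 (le_trans sq0) // le_eqVlt; apply/orP; left; apply/eqP.
by rewrite rmorphN rmorphXn /=; ring.
Qed.

Let m := inf (range energyR).

Let m_lb x : m%:C%C <= energy x.
Proof.
rewrite energyE lecR; apply: ge_inf; last by exists x.
by exists (- c ^+ 2) => _ [y _ <-]; rewrite -lecR -energyE.
Qed.

Let near_minimizer e : 0 < e -> exists x, energy x <= m%:C%C + e%:C%C.
Proof.
move=> e0; have [] := @inf_adherent _ (range energyR) e e0.
  split; first by exists (energyR 0), 0.
  by exists (- c ^+ 2) => _ [y _ <-]; rewrite -lecR -energyE.
move=> _ [x _ <-] /ltW xe; exists x.
by rewrite energyE -rmorphD lecR.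
Qed.

(** Parallelogram law: the linear terms cancel, and the midpoint of [x] and [y] has energy at least
    [m]. *)
Let near_minimizer_close e x y : energy x <= m%:C%C + e ->
  energy y <= m%:C%C + e -> `|x - y| ^+ 2 <= 4 * e.
Proof.
move=> xe ye; rewrite -hdotE.
have -> : hdot (x - y) (x - y) =
   2 * energy x + 2 * energy y - 4 * energy (2^-1 *: (x + y)).
  have V2 : (2^-1 : R[i])^* = 2^-1 by rewrite fmorphV /= conjC_nat.
  rewrite /energy !fZ !fD !hdotZl !hdotZr !hdotBl !hdotBr !hdotDl !hdotDr V2.
  by rewrite rmorphM rmorphD /= V2; field.
have h : - (4 * energy (2^-1 *: (x + y))) <= - (4 * m%:C%C).
  by rewrite lerN2 ler_pM2l ?ltr0n.
have {}xe : 2 * energy x <= 2 * (m%:C%C + e) by rewrite ler_pM2l ?ltr0n.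
have {}ye : 2 * energy y <= 2 * (m%:C%C + e) by rewrite ler_pM2l ?ltr0n.
apply: le_trans (lerD (lerD xe ye) h) _.
by rewrite le_eqVlt; apply/orP; left; apply/eqP; ring.
Qed.

(** Moving from [x] by [d^* *: h] lowers the energy by at least [|d|^2], yet it cannot fall below
    [m]. *)
Let near_minimizer_repr e x h : energy x <= m%:C%C + e -> `|h| <= 1 ->
  `|f h - hdot h x| ^+ 2 <= e.
Proof.
move=> xe h1; set d := f h - hdot h x.
have := m_lb (x + d^* *: h).
have -> : energy (x + d^* *: h) = energy x - 2 * `|d| ^+ 2 + `|d| ^+ 2 * hdot h h.
  have cD : (f x + d^* * f h)^* = (f x)^* + d * (f h)^*.
    by rewrite rmorphD rmorphM /= conjCK.
  rewrite /energy fD fZ hdotDl !hdotDr !hdotZl !hdotZr conjCK cD.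
  by rewrite normCK /d rmorphB /= [hdot x h]hdotC; ring.
set D := `|d| ^+ 2; have D0 : 0 <= D by rewrite exprn_ge0.
have Dh : D * hdot h h <= D by rewrite ler_piMr // hdotE exprn_ile1.
move=> mle; have := lerD (le_trans mle (lerD (lerB xe (lexx _)) Dh)) (lexx (D - m%:C%C)).
have -> : m%:C%C + (D - m%:C%C) = D by ring.
by have -> : m%:C%C + e - 2 * D + D + (D - m%:C%C) = e by ring.
Qed.

Lemma riesz : exists y, forall x, f x = hdot x y.
Proof.
(* The representing vector is the limit of the filter generated by the sets of near-minimizers. *)
pose F := filter_from [set e : R | 0 < e]
   (fun e => [set x | energy x <= m%:C%C + e%:C%C]).
have FF : ProperFilter F.
  apply: filter_from_proper; last by move=> e /near_minimizer.
  apply: filter_from_filter; first by exists 1 => /=.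
  move=> d e /= d0 e0; exists (Num.min d e); first by rewrite lt_min d0.
  by move=> x /= xe; split; apply: le_trans xe _; rewrite lerD2l lecR ge_min lexx ?orbT.
have /cauchy_cvg cF : cauchy F.
  apply: cauchy_exP => e e0.
  have eE : e = (complex.Re e)%:C%C by rewrite RRe_real // gtr0_real.
  set r := complex.Re e in eE.
  have r0 : 0 < r by move: e0; rewrite eE ltcR.
  (* [near_minimizer_close] then bounds squared distances by [r ^+ 2 / 2 < r ^+ 2]. *)
  have e80 : 0 < r ^+ 2 / 8 by rewrite divr_gt0 // exprn_gt0.
  have [x xe] := near_minimizer e80.
  exists x, (r ^+ 2 / 8) => // y /= ye; rewrite -ball_normE /=.
  rewrite -(@ltr_pXn2r _ 2) ?nnegrE ?(ltW e0) //.
  apply: le_lt_trans (near_minimizer_close xe ye) _.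
  have -> : 4 * (r ^+ 2 / 8)%:C%C = (4 * (r ^+ 2 / 8))%:C%C.
    by rewrite !mulr_natl rmorphMn.
  rewrite eE -rmorphXn ltcR; have := exprn_gt0 2 r0; lra.
set y := lim F in cF; exists y.
have unit_ball h : `|h| <= 1 -> f h = hdot h y.
  move=> h1; apply/eqP; rewrite -subr_eq0 -normr_le0; apply: contraT => d0.
  set d := `|_| in d0; have {}d0 : 0 < d.
    by rewrite lt_def normr_ge0 andbT; apply: contra d0 => /eqP->.
  have dE : d = (complex.Re d)%:C%C by rewrite RRe_real // gtr0_real.
  set r := complex.Re d in dE.
  have r0 : 0 < r by move: d0; rewrite dE ltcR.
  (* If the error [d] at [h] were positive, a near-minimizer [x] close to [y] would give
     [d < d / 3 + d / 3]: one third from the error at [x], one from [hdot h (y - x)]. *)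
  have Fy : F (ball y (d / 3)) by apply: cF; apply: nbhsx_ballx; rewrite divr_gt0.
  have Fe : F [set x | energy x <= m%:C%C + ((r / 3) ^+ 2)%:C%C].
    by exists ((r / 3) ^+ 2) => //=; rewrite exprn_gt0 // divr_gt0.
  have [x [+ xe]] := filter_ex (filterI Fy Fe).
  rewrite -ball_normE /= => yx.
  have := near_minimizer_repr xe h1.
  have -> : ((r / 3) ^+ 2)%:C%C = (d / 3) ^+ 2.
    by rewrite rmorphXn fmorph_div rmorph_nat [in RHS]dE.
  rewrite ler_pXn2r ?nnegrE ?divr_ge0 ?(ltW d0) // => fhx.
  have : d < d / 3 + d / 3.
    have dE' : d = `|(f h - hdot h x) - hdot h (y - x)|.
      by rewrite hdotBr opprB addrA subrK.
    rewrite [ltLHS]dE'; apply: le_lt_trans (ler_normB _ _) _.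
    apply: ler_ltD => //; apply: le_lt_trans (cauchy_schwarz _ _) _.
    by apply: le_lt_trans yx; rewrite ler_piMl.
  have -> : d / 3 + d / 3 = d * (2 / 3) by field.
  rewrite ltr_pMr // => /ltW.
  by rewrite ler_pdivlMr // mul1r ler_nat.
(* Dividing by [1 + |x|] reaches the unit ball, even for [x = 0]. *)
move=> x; have n0 : 0 < 1 + `|x| by rewrite ltr_pwDl.
have := unit_ball ((1 + `|x|)^-1 *: x).
rewrite fZ hdotZl normrZ normfV gtr0_norm // ler_pdivrMl // mulr1 ler_wpDl //.
by move=> /(_ isT)/(mulfI (invr_neq0 (lt0r_neq0 n0))).
Qed.

End Riesz.

(** * Bounded operators and their adjoints *)

Section BoundedOperators.
Context {R : realType}.
Implicit Types H K L : hilbertType R.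

Lemma bounded_operatorP H K (T : H -> K) :
  bounded_operator T -> exists2 c : R[i], 0 < c & forall x, `|T x| <= c * `|x|.
Proof.
(* On a zero space [c] may be any complex number, hence the absolute value; adding 1 makes the bound
   positive. *)
case=> _ [c Tc]; exists (1 + `|c|) => [|x]; first by rewrite ltr_pwDl.
have Tcx := Tc x.
have cx0 : 0 <= c * `|x| by apply: le_trans Tcx.
rewrite (le_trans Tcx) // -(ger0_norm cx0) normrM normr_id.
by rewrite ler_wpM2r // lerDr.
Qed.

Lemma bounded_operatorB H K (T : H -> K) x y : bounded_operator T -> T (x - y) = T x - T y.
Proof. by move=> [lT _]; rewrite addrC -scaleN1r lT scaleN1r addrC. Qed.

Lemma bounded_operator0 H K (T : H -> K) : bounded_operator T -> T 0 = 0.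
Proof. by move=> bT; rewrite -(subrr 0) (bounded_operatorB _ _ bT) subrr. Qed.

Lemma bounded_comp H K L (S : K -> L) (T : H -> K) :
  bounded_operator S -> bounded_operator T -> bounded_operator (S \o T).
Proof.
move=> bS bT; have [c c0 Sc] := bounded_operatorP bS.
have [d _ Td] := bounded_operatorP bT; case: bS bT => [lS _] [lT _].
split=> [a x y /=|]; first by rewrite lT lS.
exists (c * d) => x; apply: le_trans (Sc _) _.
by rewrite -mulrA ler_pM2l.
Qed.

Lemma bounded_sub H K (S T : H -> K) : bounded_operator S -> bounded_operator T ->
  bounded_operator (fun x => S x - T x).
Proof.
move=> [lS [c Sc]] [lT [d Td]]; split=> [a x y /=|].
  by rewrite lS lT scalerBr opprD addrACA.
exists (c + d) => x; apply: le_trans (ler_normB _ _) _.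
by rewrite mulrDl lerD.
Qed.

Lemma bounded_id H : bounded_operator (@id H).
Proof. by split=> //; exists 1 => x; rewrite mul1r. Qed.

(** Riesz represents [hdot (T x) y] as a functional of [x] for each [y]; choosing the representing
    vectors shows that [xget] does not fall back on its default. *)
Lemma adjointP H K (T : H -> K) : bounded_operator T -> is_adjoint T (adjoint T).
Proof.
move=> bT; rewrite /adjoint.
suff [S TS] : exists S, is_adjoint T S by apply: (@xgetPex _ (fun=> 0)); exists S.
have Ty y : exists z, forall x, hdot (T x) y = hdot x z.
  have [c c0 Tc] := bounded_operatorP bT.
  have cE : c = (complex.Re c)%:C%C by rewrite RRe_real // gtr0_real.
  have yE : `|y| = (complex.Re `|y|)%:C%C by rewrite RRe_real ?normr_real.
  apply: (@riesz _ _ (fun x => hdot (T x) y) (complex.Re c * complex.Re `|y|)).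
    by have [lT _] := bT; move=> a u v /=; rewrite lT hdotDl hdotZl.
  move=> x; apply: le_trans (cauchy_schwarz _ _) _.
  have -> : (complex.Re c * complex.Re `|y|)%:C%C = c * `|y|.
    by rewrite [in RHS]cE [in RHS]yE rmorphM.
  by rewrite mulrAC ler_wpM2r.
by have [S TS] := choice Ty; exists S => x y.
Qed.

Lemma hdot_adjointr H K (T : H -> K) x y : bounded_operator T ->
  hdot (adjoint T y) x = hdot y (T x).
Proof. by move=> bT; rewrite hdotC -(adjointP bT) -hdotC. Qed.

(** Cancel [|T' y|] in [|T' y|^2 = <T T' y, y> <= c |T' y| |y|], where [T'] is the adjoint. *)
Lemma adjoint_bounded H K (T : H -> K) :
  bounded_operator T -> bounded_operator (adjoint T).
Proof.
move=> bT; split=> [a x y|].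
  apply: hdot_ext => z.
  by rewrite hdotDr hdotZr -!(adjointP bT) hdotDr hdotZr.
have [c c0 Tc] := bounded_operatorP bT; exists c => y.
have [->|] := eqVneq (adjoint T y) 0; first by rewrite normr0 mulr_ge0 // ltW.
rewrite -normr_gt0 => Ty0; rewrite -(ler_pM2l Ty0) -expr2 -hdotE.
rewrite -(adjointP bT); apply: le_trans (real_ler_norm _) _.
  by rewrite (adjointP bT) hdotE rpredX ?normr_real.
apply: le_trans (cauchy_schwarz _ _) _.
by rewrite mulrCA mulrA ler_wpM2r.
Qed.

End BoundedOperators.

(** * Compactness as total boundedness *)

Section TotallyBounded.
Context {R : realType}.
Implicit Types H K L : hilbertType R.

(** The color classes cut the unit ball into finitely many pieces with images of diameter at most
    [e]; two colorings combine by pairing. *)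
Definition totally_bounded_operator H K (T : H -> K) : Prop :=
  forall e : R[i], 0 < e -> exists (I : finType) (color : H -> I),
    forall x y, `|x| <= 1 -> `|y| <= 1 -> color x = color y -> `|T x - T y| <= e.

Local Notation tbo := totally_bounded_operator.

Lemma tbo_sub H K (S T : H -> K) : tbo S -> tbo T -> tbo (fun x => S x - T x).
Proof.
move=> tS tT e e0; have e20 : 0 < e / 2 by rewrite divr_gt0.
have [I [c cS]] := tS _ e20; have [J [d dT]] := tT _ e20.
exists (I * J)%type, (fun x => (c x, d x)) => x y x1 y1 [cxy dxy].
have -> : S x - T x - (S y - T y) = (S x - S y) - (T x - T y).
  by rewrite !opprB addrACA [RHS]addrACA [- T x - _]addrC.
rewrite (splitr e); apply: le_trans (ler_normB _ _) _.
by rewrite lerD ?cS ?dT.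
Qed.

Lemma tbo_compr H K L (T : K -> L) (S : H -> K) : bounded_operator T ->
  bounded_operator S -> tbo T -> tbo (T \o S).
Proof.
move=> bT bS tT e e0; have [c c0 Sc] := bounded_operatorP bS.
have [I [d dT]] := tT _ (divr_gt0 e0 c0).
exists I, (fun x => d (c^-1 *: S x)) => x y x1 y1 dxy.
have S1 z : `|z| <= 1 -> `|c^-1 *: S z| <= 1.
  move=> z1; rewrite normrZ normfV gtr0_norm // ler_pdivrMl // mulr1.
  by apply: le_trans (Sc z) _; rewrite ger_pMr.
have := dT _ _ (S1 _ x1) (S1 _ y1) dxy.
have TZ z : T (c^-1 *: z) = c^-1 *: T z.
  by have := bT.1 c^-1 z 0; rewrite !addr0 (bounded_operator0 bT) addr0.
rewrite !TZ -scalerBr normrZ normfV gtr0_norm // mulrC.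
by rewrite ler_pM2r ?invr_gt0.
Qed.

Lemma tbo_compl H K L (T : K -> L) (S : H -> K) : bounded_operator T ->
  tbo S -> tbo (T \o S).
Proof.
move=> bT tS e e0; have [c c0 Tc] := bounded_operatorP bT.
have [I [d dS]] := tS _ (divr_gt0 e0 c0).
exists I, d => x y x1 y1 dxy /=; rewrite -bounded_operatorB //.
apply: le_trans (Tc _) _; rewrite mulrC -ler_pdivlMr //; exact: dS.
Qed.

(* [|Z x - Z y|^2 = <W (x - y), x - y> <= 2 |W x - W y|] on the unit ball. *)
Lemma tbo_square_root H K (Z : H -> K) (W : H -> H) : bounded_operator Z ->
  bounded_operator W -> (forall x, hdot (W x) x = hdot (Z x) (Z x)) ->
  tbo W -> tbo Z.
Proof.
move=> bZ bW WZ tW e e0.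
have [I [d dW]] := tW _ (divr_gt0 (exprn_gt0 2 e0) (ltr0n _ 2)).
exists I, d => x y x1 y1 dxy.
rewrite -(@ler_pXn2r _ 2) ?nnegrE ?(ltW e0) // -bounded_operatorB // -hdotE -WZ.
apply: le_trans (real_ler_norm _) _; first by rewrite WZ hdotE rpredX ?normr_real.
apply: le_trans (cauchy_schwarz _ _) _.
rewrite -[e ^+ 2](@divfK _ 2) ?pnatr_eq0 // ler_pM ?(bounded_operatorB _ _ bW) //.
  exact: dW.
by rewrite (le_trans (ler_normB _ _)) // -[2]/(1 + 1) lerD.
Qed.

(** Finitely many balls of radius [e / 2] cover the closure of the image; [x] is colored by the
    first center near [T x]. *)
Lemma compact_operator_tbo H K (T : H -> K) : compact_operator T -> tbo T.
Proof.
case=> _; rewrite precompactE compact_cover => cT e e0.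
have e20 : 0 < e / 2 by rewrite divr_gt0.
have [|D _ cD] := cT K (T @` [set x | `|x| <= 1]) (fun y => ball y (e / 2))
  (fun y _ => ball_open y (e / 2)).
  move=> y /(_ _ (nbhsx_ballx y _ e20)) [_ [[x x1 <-] yx]].
  by exists (T x); [exists x | apply: ball_sym].
set s := enum_fset D; pose center x y := `|y - T x| < e / 2.
(* The extra color is the value of [find] when no center is near, possible only outside the unit
   ball. *)
exists 'I_(size s).+1, (fun x => inord (find (center x) s)) => x y x1 y1 xy.
have has_center z : `|z| <= 1 -> has (center z) s.
  move=> z1; have /cD [y' /= Dy'] : (closure (T @` [set x | `|x| <= 1])) (T z).
    by apply: subset_closure; exists z.
  by rewrite -ball_normE /= => y'z; apply/hasP; exists y'.
have same : find (center x) s = find (center y) s.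
  by have := congr1 val xy; rewrite /= !inordK // ltnS find_size.
have := nth_find 0 (has_center _ x1); have := nth_find 0 (has_center _ y1).
rewrite /center same distrC => cy cx; rewrite distrC in cx; rewrite distrC in cy.
rewrite (splitr e) (le_trans (ler_distD (nth 0 s (find (center y) s)) _ _)) //.
by rewrite ltW // ltrD // distrC.
Qed.

(** Otherwise the ultrafilter contains the complement of each [B i], hence their finite
    intersection, which misses the union. *)
Lemma ultra_finite_cover (T : Type) (I : finType) (F : set_system T)
    (B : I -> set T) : UltraFilter F -> F (\bigcup_i B i) -> exists i, F (B i).
Proof.
move=> FU FB; apply: contrapT => /forallNP nFB.
have FN i : F (~` B i) by have [/nFB|] := in_ultra_setVsetC (B i) FU.
have FNB : F [set x | forall i, (~` B i) x] by exact: filter_forall.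
by have [x [[i _ Bi] /(_ i)]] := filter_ex (filterI FB FNB).
Qed.

Lemma tbo_compact_operator H K (T : H -> K) : linear T -> tbo T -> compact_operator T.
Proof.
move=> lT tT; split=> //; rewrite precompactE compact_ultra => F FU FA.
have FP : ProperFilter F by exact: ultra_proper.
suff /cauchy_cvg cF : cauchy F.
  exists (lim F); split => //.
  exact: (@closed_cvg _ _ _ _ id _ (@closed_closure _ _) FA).
apply: cauchy_exP => e e0; have e30 : 0 < e / 3 by rewrite divr_gt0.
have [I [c cT]] := tT _ e30.
(* The [e / 3]-neighborhoods of the images of the color classes cover the closure and have points
   less than [e] apart; so [F] contains one of them and is Cauchy. *)
pose B i := [set p | exists x, [/\ `|x| <= 1, c x = i & `|p - T x| < e / 3]].
have /ultra_finite_cover [i FBi] : F (\bigcup_i B i).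
  apply: filterS FA => p /(_ _ (nbhsx_ballx p _ e30)) [_ [[x x1 <-]]].
  by rewrite -ball_normE /= => px; exists (c x) => //; exists x.
have [z [x [x1 cx zx]]] := filter_ex FBi; exists z.
apply: filterS FBi => p [y [y1 cy py]]; rewrite -ball_normE /=.
have xy : `|T x - T y| <= e / 3 by apply: cT; rewrite ?cx.
have -> : z - p = (z - T x) + ((T x - T y) - (p - T y)).
  by rewrite opprB !subrKA.
have -> : e = e / 3 + (e / 3 + e / 3) by field.
apply: le_lt_trans (ler_normD _ _) _; apply: ltrD => //.
by apply: le_lt_trans (ler_normB _ _) _; apply: ler_ltD.
Qed.

End TotallyBounded.

(** * Projections attached to a partial isometry *)

Section PartialIsometries.
Context {R : realType}.
Implicit Types H K : hilbertType R.

(** The range of the adjoint is orthogonal to the kernel of [T], so [T] is isometric on it. Hence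
    [D = T T'] satisfies [<D y, D y> = <D y, y>], which forces [D D = D]. *)
Lemma partial_isometry_adjointK H K (T : H -> K) : bounded_operator T ->
  partial_isometry T -> forall y, adjoint T (T (adjoint T y)) = adjoint T y.
Proof.
move=> bT pT; have bT' := adjoint_bounded bT.
pose D y := T (adjoint T y).
have bD : bounded_operator D by exact: bounded_comp.
have D_sym x y : hdot (D x) y = hdot x (D y).
  by rewrite (adjointP bT) (hdot_adjointr _ _ bT).
have DD y : hdot (D y) (D y) = hdot (D y) y.
  rewrite hdotE pT -?hdotE -?(adjointP bT) // => z Tz.
  by rewrite (hdot_adjointr _ _ bT) Tz hdotC hdot0l conjC0.
pose E y := D (D y) - D y.
have bE : bounded_operator E by apply: bounded_sub => //; exact: bounded_comp.
have Eyy y : hdot (E y) y = 0 by rewrite hdotBl D_sym DD subrr.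
(* Polarization: a symmetric operator with zero quadratic form is zero. *)
have E0 y : E y = 0.
  have ED : E (y - E y) = E y - E (E y) by exact: bounded_operatorB.
  have := Eyy (y - E y); rewrite ED hdotBl !(hdotBr y (E y)) !Eyy sub0r subr0.
  have -> : hdot (E (E y)) y = hdot (E y) (E y).
    by rewrite [in LHS]/E hdotBl !D_sym -hdotBr.
  by move/eqP; rewrite -opprD oppr_eq0 -mulr2n mulrn_eq0 hdot_eq0 => /eqP.
move=> y; apply/eqP; rewrite -subr_eq0 -(bounded_operatorB _ _ bT') -hdot_eq0.
rewrite (hdot_adjointr _ _ bT) (bounded_operatorB _ _ bT') (bounded_operatorB _ _ bT).
by rewrite -/(D y) -/(D (D y)) -/(E y) E0 hdotC hdot0l conjC0.
Qed.

Lemma partial_isometryK H K (T : H -> K) : bounded_operator T ->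
  partial_isometry T -> forall x, T (adjoint T (T x)) = T x.
Proof.
move=> bT pT x; apply: hdot_ext => z.
rewrite -!(hdot_adjointr _ _ bT) -(adjointP bT) -(hdot_adjointr _ _ bT).
by rewrite partial_isometry_adjointK.
Qed.

End PartialIsometries.

(** * Self-commutators on a submodule and on the quotient *)

Section Quotient.
Context {R : realType} {H K : hilbertType R}.
Variables (T : H -> H) (S : K -> K) (X : H -> K).
Hypotheses (bT : bounded_operator T) (bS : bounded_operator S).
Hypotheses (bX : bounded_operator X) (pX : partial_isometry X).
Hypothesis XT : forall x, X (T x) = S (X x).

Local Notation T' := (adjoint T).
Local Notation S' := (adjoint S).
Local Notation X' := (adjoint X).

(** The orthogonal projection onto the kernel of [X]. *)
Let P x := x - X' (X x).

(** The second hypothesis concerns the self-commutator of [T] restricted to the kernel of [X], the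
    conclusion that of [S] restricted to the range of [X], both extended by zero. Their common shape
    lets the lemma be iterated. *)
Lemma quotient_tbo :
  totally_bounded_operator (self_commutator T) ->
  totally_bounded_operator (fun x => P (T' (T (P x))) - T (P (T' x))) ->
  totally_bounded_operator
    (fun y => X (X' (S' (S (X (X' y))))) - S (X (X' (S' y)))).
Proof.
move=> tT tP.
have bT' := adjoint_bounded bT; have bX' := adjoint_bounded bX.
have bP : bounded_operator P.
  by apply: bounded_sub; [exact: bounded_id | exact: bounded_comp].
have XK := partial_isometryK bX pX.
have XK' := partial_isometry_adjointK bX pX.
have T'X' y : T' (X' y) = X' (S' y).
  apply: hdot_ext => z.
  by rewrite -(adjointP bT) -(adjointP bX) XT (adjointP bS) (adjointP bX).
have XP x : X (P x) = 0 by rewrite /P (bounded_operatorB _ _ bX) XK subrr.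
(* [T] preserves the kernel of [X], which gives [P T P = T P] and dually [P T' P = P T']. *)
have XTP x : X (T (P x)) = 0 by rewrite XT XP (bounded_operator0 bS).
have PTP x : P (T (P x)) = T (P x) by rewrite {1}/P XTP (bounded_operator0 bX') subr0.
have PX' y : P (X' y) = 0 by rewrite /P XK' subrr.
have PT'P x : P (T' (P x)) = P (T' x).
  by rewrite {2}/P (bounded_operatorB _ _ bT') (bounded_operatorB _ _ bP) T'X' PX' subr0.
have P_sym x y : hdot (P x) y = hdot x (P y).
  by rewrite hdotBl hdotBr (hdot_adjointr _ _ bX) (adjointP bX).
(* With [Z = X T' P], the operator [W] below is [Z' Z]; it is totally bounded
   because it is the difference of the second hypothesis and [P [T', T] P]. *)
pose Z x := X (T' (P x)); pose W x := P (T (X' (X (T' (P x))))).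
have bZ : bounded_operator Z.
  exact: (bounded_comp bX (bounded_comp bT' bP)).
have bW : bounded_operator W.
  exact: (bounded_comp bP (bounded_comp bT (bounded_comp bX' bZ))).
have bcomm : bounded_operator (self_commutator T).
  by apply: bounded_sub; exact: bounded_comp.
have tPcP : totally_bounded_operator (P \o (self_commutator T \o P)).
  by apply: tbo_compl => //; exact: tbo_compr.
have tW : totally_bounded_operator W.
  suff -> : W = fun x => (P (T' (T (P x))) - T (P (T' x))) -
      (P \o (self_commutator T \o P)) x by exact: tbo_sub.
  apply/funext => x; rewrite /= /self_commutator (bounded_operatorB _ _ bP).
  rewrite opprB addrC addrA subrK -PT'P -[in RHS]PTP.
  rewrite -(bounded_operatorB _ _ bP) -(bounded_operatorB _ _ bT).
  by rewrite /W {4}/P opprB addrC subrK.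
have tZ : totally_bounded_operator Z.
  apply: (tbo_square_root bZ bW) tW => x.
  by rewrite /W P_sym (adjointP bT) (hdot_adjointr _ _ bX).
have tXcX : totally_bounded_operator (X \o (self_commutator T \o X')).
  by apply: tbo_compl => //; exact: tbo_compr.
have tZPTX : totally_bounded_operator (Z \o (P \o (T \o X'))).
  by apply: tbo_compr => //; apply: bounded_comp => //; exact: bounded_comp.
(* The lower right corner of the self-commutator exceeds that of the quotient by [B* B], here
   [Z P T X']. *)
have -> : (fun y => X (X' (S' (S (X (X' y))))) - S (X (X' (S' y)))) =
    fun y => (X \o (self_commutator T \o X')) y - (Z \o (P \o (T \o X'))) y.
  apply/funext => y; rewrite /= /self_commutator (bounded_operatorB _ _ bX) /Z.
  have PP x : P (P x) = P x by rewrite {1}/P XP (bounded_operator0 bX') subr0.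
  rewrite PP {1}/P (bounded_operatorB _ _ bT') (bounded_operatorB _ _ bX).
  rewrite opprB [RHS]addrC subrKA.
  by rewrite !XT !T'X'.
exact: tbo_sub.
Qed.

End Quotient.

(** * Descent along the resolution *)

Theorem theorem3 (R : realType) (A : complexAlgType R) (n : nat)
    (M : nat -> hilbertModType A) (X : forall i : nat, M i.+1 -> M i) :
  strong_resolution n X ->
  (forall i : nat, (1 <= i <= n.+1)%N -> essentially_reductive (M i)) ->
  essentially_reductive (M 0%N).
Proof.
move=> [[mX X0 exact_X Xn] pX] erM a.
pose T i : M i -> M i := act a.
have bT i : bounded_operator (T i) by exact: act_bounded.
(* [D i] is the projection onto the range of [X i]. *)
pose D i y := X i (adjoint (X i) y).
have ker_proj i : (i <= n)%N -> forall y,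
    operator_ker (X i) (y - adjoint (X i) (X i y)).
  move=> lein y; have [bX _] := mX _ lein.
  rewrite /operator_ker /= (bounded_operatorB _ _ bX).
  by rewrite partial_isometryK ?subrr //; exact: pX.
(* Induction on [k = n - i]: the action on [M i], restricted to the range of [X i], has a totally
   bounded self-commutator. *)
have level k i : (k + i)%N = n -> totally_bounded_operator
    (fun y => D i (adjoint (T i) (T i (D i y))) - T i (D i (adjoint (T i) y))).
  elim: k i => [|k IH] i kin; have lein : (i <= n)%N by rewrite -kin leq_addl.
    have [bX actX] := mX _ lein; apply: quotient_tbo => //; [exact: pX|exact: actX| |].
      by apply: compact_operator_tbo; exact: erM.
    (* At [i = n] the kernel is zero, so the submodule term vanishes and one color suffices. *)
    have P0 y : y - adjoint (X i) (X i y) = 0.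
      by have := ker_proj _ lein y; move: Xn; rewrite -kin => ->.
    move=> e e0; exists unit, (fun=> tt) => x y _ _ _.
    by rewrite !P0 (bounded_operator0 (bT _)) !subrr normr0 ltW.
  have ltin : (i < n)%N by rewrite -kin addSn ltnS leq_addl.
  have [bX actX] := mX _ lein; have [bX1 _] := mX _ ltin.
  apply: quotient_tbo => //; [exact: pX|exact: actX| |].
    by apply: compact_operator_tbo; exact: erM.
  (* By exactness, the projections onto ker (X i) and range (X i.+1) agree. *)
  have DE y : y - adjoint (X i) (X i y) = D i.+1 y.
    have XX1 w : X i (X i.+1 w) = 0.
      suff : operator_ker (X i) (X i.+1 w) by [].
      by rewrite -exact_X //; exists w.
    have bX1' := adjoint_bounded bX1; set q := adjoint (X i) (X i y).
    (* [D i.+1] kills [q], which is orthogonal to the range of [X i.+1], and fixes [y - q], which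
       lies in it. *)
    have Dq : D i.+1 q = 0.
      rewrite /D (_ : adjoint _ q = 0) ?(bounded_operator0 bX1) //; apply: hdot_ext => w.
      by rewrite -(adjointP bX1) -(adjointP bX) XX1 hdot0l hdotC hdot0l conjC0.
    have := ker_proj _ lein y; rewrite -exact_X // -/q => -[z _ zE].
    rewrite -[RHS]subr0 -Dq -(bounded_operatorB _ _ (bounded_comp bX1 bX1')) /= -zE.
    by rewrite partial_isometryK //; exact: pX.
  have := IH i.+1; rewrite addnS -addSn => /(_ kin).
  by congr totally_bounded_operator; apply/funext => y; rewrite !DE.
(* Since [X 0] is onto, the statement at level 0 concerns the full self-commutator on [M 0]. *)
have D0 y : D 0%N y = y.
  have [x _ <-] : range (X 0%N) y by rewrite X0.
  by apply: partial_isometryK; [exact: (mX 0%N _).1 | exact: pX].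
apply: tbo_compact_operator.
  by case: (bounded_sub (bounded_comp (adjoint_bounded (bT 0%N)) (bT 0%N))
    (bounded_comp (bT 0%N) (adjoint_bounded (bT 0%N)))).
have := level n 0%N (addn0 n); congr totally_bounded_operator.
by apply/funext => y; rewrite !D0.
Qed.
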